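(* Let $n\geq 2$. The Andreadakis equality holds for $hP\Sigma_n$: for every $j\geq 1$, \[\Gamma_j(hP\Sigma_n)=hP\Sigma_n\cap\mathcal A_j(RF_n).\]
   Context: Notation: $x^y=y^{-1}xy$, $[x,y]=xyx^{-1}y^{-1}$, $\Gamma_*$ is the lower central series ($\Gamma_1=G$, $\Gamma_{k+1}=[G,\Gamma_k]$). $RF_n=\langle x_1,\dots,x_n\mid [x_i,x_i^w]=1\ (w\in F_n)\rangle$ is the reduced free group. $hP\Sigma_n$ is the subgroup of $\mathrm{Aut}(RF_n)$ of automorphisms sending each $x_i$ to a conjugate of $x_i$. The Andreadakis filtration is $\mathcal A_j(RF_n)=\{\sigma\in\mathrm{Aut}(RF_n) : \sigma(g)g^{-1}\in\Gamma_{i+j}(RF_n)\ \forall i\geq1,\ \forall g\in\Gamma_i(RF_n)\}$. *)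

(* Defs.v *)
From mathcomp Require Import all_boot.
Set Implicit Arguments. Unset Strict Implicit. Unset Printing Implicit Defensive.

Section Ops.
Variables (T : Type) (mul : T -> T -> T) (inv : T -> T) (one : T).

Record is_group : Prop := IsGroup {
  mulA : forall a b c, mul a (mul b c) = mul (mul a b) c;
  mul1g : forall a, mul one a = a;
  mulg1 : forall a, mul a one = a;
  mulVg : forall a, mul (inv a) a = one;
  mulgV : forall a, mul a (inv a) = one }.

Definition comm (a b : T) : T := mul (mul a b) (mul (inv a) (inv b)).
Definition conj (a b : T) : T := mul (mul (inv b) a) b.

Definition gen (S : T -> Prop) (g : T) : Prop :=
  forall P : T -> Prop, P one -> (forall a b, P a -> P b -> P (mul a b)) ->
    (forall a, P a -> P (inv a)) -> (forall a, S a -> P a) -> P g.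

(* lower central series of the subgroup H: Gamma_1 = H,
   Gamma_{k+1} = [H, Gamma_k]  (index 0 is also set to H, unused) *)
Fixpoint lcs (H : T -> Prop) (k : nat) : T -> Prop :=
  match k with
  | 0 => H
  | 1 => H
  | S k' => gen (fun c => exists a b, H a /\ lcs H k' b /\ c = comm a b)
  end.

End Ops.

Definition is_hom (G H : Type) (mulG : G -> G -> G) (mulH : H -> H -> H)
  (f : G -> H) : Prop := forall a b, f (mulG a b) = mulH (f a) (f b).

(* The defining relations of RF_n for a family y : 'I_n -> H :
   [y_i, y_i^w] = 1 for every w in the subgroup generated by the y_i
   (= image of F_n). *)
Definition rf_relations (H : Type) (mul : H -> H -> H) (inv : H -> H) (one : H)
  (n : nat) (y : 'I_n -> H) : Prop :=
  forall i w, gen mul inv one (fun z => exists k, z = y k) w ->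
    comm mul inv (y i) (conj mul inv (y i) w) = one.

(* (G, x) is the reduced free group RF_n on generators x_1..x_n, i.e. the group
   presented by <x_1..x_n | [x_i, x_i^w] = 1 (w in F_n)>, characterised by its
   universal property (plus generation, which follows from it). *)
Definition is_reduced_free (G : Type) (mul : G -> G -> G) (inv : G -> G) (one : G)
  (n : nat) (x : 'I_n -> G) : Prop :=
  [/\ is_group mul inv one,
      forall g, gen mul inv one (fun z => exists k, z = x k) g,
      rf_relations mul inv one x &
      forall (H : Type) (mulH : H -> H -> H) (invH : H -> H) (oneH : H)
             (y : 'I_n -> H),
        is_group mulH invH oneH -> rf_relations mulH invH oneH y ->
        (exists phi : G -> H, is_hom mul mulH phi /\ forall k, phi (x k) = y k) /\
        (forall phi psi : G -> H, is_hom mul mulH phi -> is_hom mul mulH psi ->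
           (forall k, phi (x k) = y k) -> (forall k, psi (x k) = y k) ->
           forall g, phi g = psi g)].

(* Automorphisms of G are represented as pairs (sigma, sigma^-1) of mutually
   inverse homomorphisms; the group law on pairs is composition. *)
Section Aut.
Variables (G : Type) (mul : G -> G -> G) (inv : G -> G) (one : G).

Definition autT := ((G -> G) * (G -> G))%type.
Definition aut_mul (p q : autT) : autT :=
  (fun g => p.1 (q.1 g), fun g => q.2 (p.2 g)).
Definition aut_inv (p : autT) : autT := (p.2, p.1).
Definition aut_one : autT := (fun g => g, fun g => g).

Definition is_aut (p : autT) : Prop :=
  [/\ is_hom mul mul p.1, is_hom mul mul p.2,
      forall g, p.1 (p.2 g) = g & forall g, p.2 (p.1 g) = g].

Definition hPSigma (n : nat) (x : 'I_n -> G) (p : autT) : Prop :=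
  is_aut p /\ forall i, exists w, p.1 (x i) = conj mul inv (x i) w.

Definition andreadakis (j : nat) (p : autT) : Prop :=
  is_aut p /\ forall i, 1 <= i -> forall g, lcs mul inv one (fun _ => True) i g ->
    lcs mul inv one (fun _ => True) (i + j) (mul (p.1 g) (inv g)).

End Aut.

(* Main.v *)
(* An element of hPSigma is x_i |-> x_i^{w_i}. For the inclusion of A_j in Gamma_j, one first
   shows that w_i may be taken in Gamma_j. By retracting, w_i may be assumed to avoid x_i. Let
   RF_n act on the noncommutative power series modulo words with a repeated letter by
   x_k = 1 + X_k: elements of Gamma_k act as 1 + (degree >= k), so if [x_i, w_i] is in
   Gamma_{j+1}, the coefficients of w_i in degrees 1, ..., j-1 vanish. This forces w_i in
   Gamma_j by induction on the letters occurring in w_i: modulo the subgroup on the other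
   letters, w_i is a product of the commuting brackets [x_{k1}, [..., [x_{kr}, x_s]]] with
   distinct letters, whose exponents are read off as coefficients of X_{k1} ... X_{kr} X_s.
   Next, for v in H_i = <x_k, k <> i>, the automorphism fixing all letters except
   x_i |-> x_i^v depends multiplicatively on v, so it lies in Gamma_j(hPSigma) when v is in
   Gamma_j(H_i). Composing sigma with such automorphisms fixes one letter at a time, hence
   reaches the identity.
   The other inclusion follows from [A_i, A_j] in A_{i+j} and hPSigma in A_1. *)
Require Import Defs.
From Stdlib Require Import ZArith Lia FunctionalExtensionality ProofIrrelevance.
From mathcomp Require Import all_boot.
From mathcomp Require Import zify.
(* Required again because MathComp's group theory shadows [comm], [conj], [mulVg], etc. *)
Require Import Defs.
Set Implicit Arguments. Unset Strict Implicit. Unset Printing Implicit Defensive.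

(** * Group identities, generated subgroups and lower central series *)

Section Groups.
Variables (T : Type) (mul : T -> T -> T) (inv : T -> T) (one : T).
Hypothesis HG : is_group mul inv one.
Local Notation "a ** b" := (mul a b) (at level 40, left associativity).
Local Notation gen := (gen mul inv one).
Local Notation comm := (comm mul inv).
Local Notation conj := (conj mul inv).

Lemma gA a b c : a ** b ** c = a ** (b ** c). Proof. by rewrite (mulA HG). Qed.
Lemma gVK a b : inv a ** (a ** b) = b.
Proof. by rewrite -gA (mulVg HG) (mul1g HG). Qed.
Lemma gKV a b : a ** (inv a ** b) = b.
Proof. by rewrite -gA (mulgV HG) (mul1g HG). Qed.
Lemma gcancel a b c : a ** b = a ** c -> b = c.
Proof. by move=> e; rewrite -(gVK a b) e gVK. Qed.
Lemma ginv1 : inv one = one.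
Proof. by rewrite -[LHS](mul1g HG) (mulgV HG). Qed.
Lemma ginvK a : inv (inv a) = a.
Proof. by apply: (@gcancel (inv a)); rewrite (mulgV HG) (mulVg HG). Qed.
Lemma ginvM a b : inv (a ** b) = inv b ** inv a.
Proof. by apply: (@gcancel (a ** b)); rewrite (mulgV HG) gA gKV (mulgV HG). Qed.

(* Confluent for the free group: [rewrite !gE] decides group identities. *)
Definition gE :=
  (gA, gVK, gKV, ginv1, ginvK, ginvM, mul1g HG, mulg1 HG, mulVg HG, mulgV HG).

Lemma comm1_commute a b : comm a b = one -> a ** b = b ** a.
Proof.
rewrite /comm => e.
have : a ** b = (a ** b ** (inv a ** inv b)) ** (b ** a) by rewrite !gE.
by rewrite e (mul1g HG).
Qed.
Lemma commute_comm1 a b : a ** b = b ** a -> comm a b = one.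
Proof. by move=> e; rewrite /comm e !gE. Qed.

Lemma gen_one S : gen S one. Proof. by move=> P. Qed.
Lemma gen_mul S a b : gen S a -> gen S b -> gen S (a ** b).
Proof. by move=> Sa Sb P P1 PM PV PS; apply: (PM); [apply: (Sa P) | apply: (Sb P)]. Qed.
Lemma gen_inv S a : gen S a -> gen S (inv a).
Proof. by move=> Sa P P1 PM PV PS; apply: (PV); apply: (Sa P). Qed.
Lemma gen_mem (S : T -> Prop) a : S a -> gen S a.
Proof. by move=> Sa P P1 PM PV PS; apply: PS. Qed.
Lemma gen_ind (S P : T -> Prop) :
  P one -> (forall a b, P a -> P b -> P (a ** b)) -> (forall a, P a -> P (inv a)) ->
  (forall a, S a -> P a) -> forall a, gen S a -> P a.
Proof. by move=> P1 PM PV PS a; apply. Qed.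
Lemma gen_sub (S S' : T -> Prop) a :
  (forall b, S b -> gen S' b) -> gen S a -> gen S' a.
Proof.
by move=> SS'; move: a; apply: gen_ind => //; [exact: gen_mul|exact: gen_inv].
Qed.

Lemma gen_conj (S : T -> Prop) c a :
  (forall b, S b -> gen S (c ** b ** inv c)) -> gen S a -> gen S (c ** a ** inv c).
Proof.
move=> Sc; move: a; apply: gen_ind => //.
- by rewrite !gE; exact: gen_one.
- move=> a b ha hb; have -> : c ** (a ** b) ** inv c =
    (c ** a ** inv c) ** (c ** b ** inv c) by rewrite !gE.
  exact: gen_mul.
- move=> a ha; have -> : c ** inv a ** inv c = inv (c ** a ** inv c) by rewrite !gE.
  exact: gen_inv.
Qed.

Lemma commuteV a b : a ** b = b ** a -> inv a ** b = b ** inv a.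
Proof.
move=> e; have -> : inv a ** b = inv a ** (b ** a) ** inv a by rewrite !gE.
by rewrite -e !gE.
Qed.

Lemma gen_commute1 (S : T -> Prop) a c :
  (forall b, S b -> b ** c = c ** b) -> gen S a -> a ** c = c ** a.
Proof.
move=> Sc; move: a; apply: gen_ind => //.
- by rewrite !gE.
- by move=> a b ha hb; rewrite gA hb -!gA ha.
- by move=> a; exact: commuteV.
Qed.

Lemma gen_commute (S : T -> Prop) a b :
  (forall c d, S c -> S d -> c ** d = d ** c) -> gen S a -> gen S b -> a ** b = b ** a.
Proof.
move=> Sc ha hb; apply: gen_commute1 ha => c cS; symmetry.
by apply: gen_commute1 hb => d dS; apply: Sc.
Qed.

Section LowerCentral.
Variable H : T -> Prop.
Local Notation L := (lcs mul inv one H).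

Lemma lcsS k : L k.+2 = gen (fun c => exists a b, H a /\ L k.+1 b /\ c = comm a b).
Proof. by []. Qed.

Lemma lcs_comm k a b : H a -> L k.+1 b -> L k.+2 (comm a b).
Proof. by move=> Ha Lb; rewrite lcsS; apply: gen_mem; exists a, b. Qed.

Hypotheses (H1 : H one) (HM : forall a b, H a -> H b -> H (a ** b))
  (HV : forall a, H a -> H (inv a)).

Lemma lcs_one k : L k one.
Proof. by case: k => [|[|k]] //; exact: gen_one. Qed.
Lemma lcs_mul k a b : L k a -> L k b -> L k (a ** b).
Proof. by case: k => [|[|k]] //; [apply: HM | apply: HM | apply: gen_mul]. Qed.
Lemma lcs_inv k a : L k a -> L k (inv a).
Proof. by case: k => [|[|k]] //; [apply: HV | apply: HV | apply: gen_inv]. Qed.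

Lemma lcs_dec1 k a : L k.+1 a -> L k a.
Proof.
(* Indices 0 and 1 both denote [H], so the inclusion has content only from [L 2] on. *)
case: k => [//|k]; elim: k a => [|k IH] a.
- move: a; apply: gen_ind; [exact: H1|exact: HM|exact: HV|].
  move=> c [x [y [hx [hy ->]]]]; rewrite /comm /=; auto.
- rewrite lcsS [L k.+2]lcsS; apply: gen_sub => c [x [y [hx [hy ->]]]].
  by apply: gen_mem; exists x, y; split => //; split => //; apply: IH.
Qed.

Lemma lcs_dec k l a : k <= l -> L l a -> L k a.
Proof.
move/subnK <-; elim: (l - k) => [//|d IH]; rewrite addSn => /lcs_dec1; exact: IH.
Qed.

Lemma lcs_sub k a : L k a -> H a.
Proof. by move/(lcs_dec (leq0n k)). Qed.

Lemma lcs_conj k a b : H a -> L k b -> L k (a ** b ** inv a).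
Proof.
case: k => [|k] Ha Lb; first by apply: HM; [apply: HM|apply: HV].
have -> : a ** b ** inv a = comm a b ** b by rewrite /comm !gE.
by apply: lcs_mul => //; apply: lcs_dec1; apply: lcs_comm.
Qed.

End LowerCentral.
End Groups.

(** * Images of generated subgroups and lower central series under homomorphisms *)

Section Homs.
Variables (T U : Type) (mul : T -> T -> T) (inv : T -> T) (one : T).
Variables (mulU : U -> U -> U) (invU : U -> U) (oneU : U).
Hypotheses (HT : is_group mul inv one) (HU : is_group mulU invU oneU).
Variable f : T -> U.
Hypothesis fM : is_hom mul mulU f.

Lemma hom1 : f one = oneU.
Proof.
by apply: (gcancel HU (a := f one)); rewrite -fM !(gE HT) !(gE HU).
Qed.
Lemma homV a : f (inv a) = invU (f a).
Proof.
by apply: (gcancel HU (a := f a)); rewrite -fM !(gE HT) !(gE HU) hom1.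
Qed.
Lemma hom_comm a b : f (comm mul inv a b) = comm mulU invU (f a) (f b).
Proof. by rewrite /comm !fM !homV. Qed.
Lemma hom_conj a b : f (conj mul inv a b) = conj mulU invU (f a) (f b).
Proof. by rewrite /conj !fM !homV. Qed.

Lemma hom_gen (S : T -> Prop) (S' : U -> Prop) a :
  (forall b, S b -> gen mulU invU oneU S' (f b)) ->
  gen mul inv one S a -> gen mulU invU oneU S' (f a).
Proof.
move=> SS'; move: a; apply: gen_ind => //.
- by rewrite hom1; apply: gen_one.
- by move=> a b; rewrite fM; apply: gen_mul.
- by move=> a; rewrite homV; apply: gen_inv.
Qed.

Lemma hom_lcs (H : T -> Prop) (H' : U -> Prop) k a :
  (forall b, H b -> H' (f b)) -> lcs mul inv one H k a -> lcs mulU invU oneU H' k (f a).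
Proof.
move=> HH'; case: k => [|k]; first exact: HH'.
elim: k a => [|k IH] a; first exact: HH'.
rewrite !lcsS; apply: hom_gen => c [x [y [hx [hy ->]]]].
apply: gen_mem; rewrite hom_comm; exists (f x), (f y).
by split; [apply: HH'|split; [apply: IH|]].
Qed.
End Homs.

(** * The Andreadakis filtration and its commutator estimates *)

Section Andreadakis.
Variables (G : Type) (mul : G -> G -> G) (inv : G -> G) (one : G).
Hypothesis HG : is_group mul inv one.
Local Notation "a ** b" := (mul a b) (at level 40, left associativity).
Local Notation comm := (comm mul inv).
Local Notation Gam := (lcs mul inv one (fun _ => True)).
Local Notation A := (andreadakis mul inv one).
Local Notation is_aut := (is_aut mul).

Lemma gam1 k : Gam k one. Proof. exact: lcs_one. Qed.
Lemma gamM k a b : Gam k a -> Gam k b -> Gam k (a ** b).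
Proof. exact: lcs_mul. Qed.
Lemma gamV k a : Gam k a -> Gam k (inv a). Proof. exact: lcs_inv. Qed.
Lemma gam_dec k l a : k <= l -> Gam l a -> Gam k a.
Proof. exact: lcs_dec. Qed.
Lemma gamJ k a b : Gam k b -> Gam k (a ** b ** inv a).
Proof. exact: lcs_conj. Qed.
Lemma gam_comm k a b : Gam k.+1 b -> Gam k.+2 (comm a b).
Proof. exact: lcs_comm. Qed.
Lemma gam_hom f k a : is_hom mul mul f -> Gam k a -> Gam k (f a).
Proof. by move=> fM; apply: (hom_lcs HG HG fM). Qed.
Lemma commV a b : inv (comm a b) = comm b a.
Proof. by rewrite /Defs.comm !(gE HG). Qed.

Lemma is_aut_one : is_aut (aut_one G). Proof. by split. Qed.
Lemma is_aut_inv p : is_aut p -> is_aut (aut_inv p).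
Proof. by case. Qed.
Lemma is_aut_mul p q : is_aut p -> is_aut q -> is_aut (aut_mul p q).
Proof.
case=> p1 p2 p3 p4 [q1 q2 q3 q4]; split => /=.
- by move=> a b /=; rewrite q1 p1.
- by move=> a b /=; rewrite p2 q2.
- by move=> g; rewrite q3.
- by move=> g; rewrite p4.
Qed.

(** The second component is the inverse of the first and hence determined by it; functional
    extensionality turns pointwise agreement into equality of pairs. *)
Lemma aut_eq p q : is_aut p -> is_aut q -> (forall g, p.1 g = q.1 g) -> p = q.
Proof.
case: p q => p p' [q q'] /= [_ _ /= p3 p4] [_ _ /= q3 q4] /= e.
have e1 : p = q by apply: functional_extensionality.
congr pair => //; apply: functional_extensionality => g.
by rewrite -{1}(q3 g) -e1 p4.
Qed.

Lemma andr_one j : A j (aut_one G).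
Proof. by split; [exact: is_aut_one|move=> i _ g _ /=; rewrite !(gE HG); exact: gam1]. Qed.
Lemma andr_mul j p q : A j p -> A j q -> A j (aut_mul p q).
Proof.
case=> ap hp [aq hq]; split; first exact: is_aut_mul.
move=> i i0 g gg /=; have [p1 _ _ _] := ap.
have -> : p.1 (q.1 g) ** inv g = p.1 (q.1 g ** inv g) ** (p.1 g ** inv g).
  by rewrite p1 (homV HG HG p1) !(gE HG).
by apply: gamM; [apply: gam_hom => //; apply: hq|apply: hp].
Qed.
Lemma andr_inv j p : A j p -> A j (aut_inv p).
Proof.
case=> ap hp; split; first exact: is_aut_inv.
move=> i i0 g gg /=; have [p1 p2 p3 p4] := ap.
have -> : p.2 g ** inv g = p.2 (inv (p.1 g ** inv g)).
  by rewrite (homV HG HG p2) p2 p4 (homV HG HG p2) !(gE HG).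
by apply: gam_hom => //; apply: gamV; apply: hp.
Qed.

(** The estimate on commutators in [G] is kept as a hypothesis because its general form,
    [gam_comm_add], is itself derived from this lemma, applied to inner automorphisms. *)
Lemma andr_comm_of i j p q :
  (forall k a b, 0 < k -> Gam (k + i) a -> Gam (k + j) b -> Gam (k + (i + j)) (comm b a)) ->
  A i p -> A j q -> A (i + j) (Defs.comm (@aut_mul G) (@aut_inv G) p q).
Proof.
move=> K [ap hp] [aq hq].
split; first by do !apply: is_aut_mul => //; apply: is_aut_inv.
move=> k k0 g gg /=; have [p1 p2 p3 p4] := ap; have [q1 q2 q3 q4] := aq.
(* With g = q(p(h)), the quotient to bound is p(q(h)) q(p(h))^-1. Writing p(h) = a h and q(h) = b h
   splits it into an error of p on b, the commutator [b, a] and an error of q on a. *)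
set h := p.2 (q.2 g).
have gh : Gam k h by do !apply: gam_hom => //.
have -> : inv g = inv (q.1 (p.1 h)) by rewrite /h p3 q3.
set a := p.1 h ** inv h; set b := q.1 h ** inv h.
have Ga : Gam (k + i) a by apply: hp.
have Gb : Gam (k + j) b by apply: hq.
have -> : p.1 (q.1 h) ** inv (q.1 (p.1 h)) =
  (p.1 b ** inv b) ** comm b a ** inv (q.1 a ** inv a).
  by rewrite /Defs.comm p1 q1 /a /b (homV HG HG p1) (homV HG HG q1) !(gE HG).
apply: gamM; last first.
  by apply: gamV; rewrite addnA; apply: hq => //; rewrite addn_gt0 k0.
apply: gamM; last exact: K.
by rewrite [i + j]addnC addnA; apply: hp => //; rewrite addn_gt0 k0.
Qed.

Definition inner a : autT G :=
  (fun g => a ** g ** inv a, fun g => inv a ** g ** a).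
Lemma is_aut_inner a : is_aut (inner a).
Proof. by split => [b c|b c|b|b]; rewrite /= !(gE HG). Qed.

Lemma inner_andr1 a : A 1 (inner a).
Proof.
split; first exact: is_aut_inner.
move=> [//|i] _ g gg /=.
have -> : a ** g ** inv a ** inv g = comm a g by rewrite /Defs.comm !(gE HG).
by rewrite addn1; apply: gam_comm.
Qed.

(** The map [inner] is a homomorphism, so it turns the generators [a, b] of the next term into
    commutators of automorphisms. Since the first index is 1, the hypothesis of [andr_comm_of]
    follows from the definition of the series. *)
Lemma inner_andr i a : Gam i.+1 a -> A i.+1 (inner a).
Proof.
elim: i a => [|i IH] a; first by move=> _; exact: inner_andr1.
have innM b c : inner (b ** c) = aut_mul (inner b) (inner c).
  apply: aut_eq; [exact: is_aut_inner|apply: is_aut_mul; exact: is_aut_inner|].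
  by move=> g /=; rewrite !(gE HG).
have innV b : inner (inv b) = aut_inv (inner b).
  apply: aut_eq; [exact: is_aut_inner|apply: is_aut_inv; exact: is_aut_inner|].
  by move=> g /=; rewrite !(gE HG).
rewrite lcsS; move: a; apply: gen_ind.
- have -> : inner one = aut_one G.
    apply: aut_eq; [exact: is_aut_inner|exact: is_aut_one|].
    by move=> g /=; rewrite !(gE HG).
  exact: andr_one.
- by move=> a b ha hb; rewrite innM; apply: andr_mul.
- by move=> a ha; rewrite innV; apply: andr_inv.
- move=> c [a [b [_ [hb ->]]]].
  rewrite /Defs.comm !innM !innV; rewrite -[i.+2]add1n.
  apply: andr_comm_of; [|exact: inner_andr1|exact: IH].
  move=> [//|k] x y _ gx gy; rewrite -commV; apply: gamV.
  by have := @gam_comm (k + i.+1) x y; rewrite -addSn => /(_ gy); apply: gam_dec; lia.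
Qed.

(** The commutator [a, b] is [inner a] applied to b, times b^-1, so [inner_andr] gives the bound
    without the three subgroups lemma. *)
Lemma gam_comm_add i j a b : 0 < i -> 0 < j ->
  Gam i a -> Gam j b -> Gam (i + j) (comm a b).
Proof.
case: i => [//|i] _ j0 ga gb; have [_ /(_ _ j0 _ gb) /=] := inner_andr ga.
by rewrite addnC /Defs.comm !(gE HG).
Qed.

Lemma andr_comm i j p q : 0 < i -> 0 < j ->
  A i p -> A j q -> A (i + j) (Defs.comm (@aut_mul G) (@aut_inv G) p q).
Proof.
move=> i0 j0; apply: andr_comm_of => k a b k0 ga gb.
have : Gam ((k + j) + (k + i)) (comm b a) by apply: gam_comm_add => //; lia.
by apply: gam_dec; lia.
Qed.

(** Gamma_k is normal and preserved by p, so the elements fixed modulo Gamma_k form a subgroup and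
    generators suffice. *)
Lemma gen_fixed_mod k p (S : G -> Prop) g : is_hom mul mul p ->
  (forall a, S a -> Gam k (p a ** inv a)) -> Defs.gen mul inv one S g ->
  Gam k (p g ** inv g).
Proof.
move=> pM pS; move: g; apply: gen_ind => //.
- by rewrite (hom1 HG HG pM) !(gE HG); exact: gam1.
- move=> a b ha hb.
  have -> : p (a ** b) ** inv (a ** b) =
     p a ** (p b ** inv b) ** inv (p a) ** (p a ** inv a).
    by rewrite pM !(gE HG).
  by apply: gamM => //; apply: gamJ.
- move=> a ha; have -> : p (inv a) ** inv (inv a) =
     inv (p a) ** inv (p a ** inv a) ** inv (inv (p a)).
    by rewrite (homV HG HG pM) !(gE HG).
  by apply: gamJ; apply: gamV.
Qed.

Lemma andr1_of_abelianization p : is_aut p ->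
  (forall g, Gam 2 (p.1 g ** inv g)) -> A 1 p.
Proof.
move=> ap h; split=> //; have [p1 _ _ _] := ap.
elim=> [//|[|i] IH] _ g; first by move=> _; exact: h.
rewrite lcsS addn1; apply: gen_fixed_mod => // c [a [b [_ [gb ->]]]].
have gd := IH isT b gb; rewrite addn1 in gd.
set c' := p.1 a ** inv a; set d := p.1 b ** inv b; rewrite -/d in gd.
set e := comm a b.
have ge : Gam i.+2 e by apply: gam_comm.
(* Each factor lies in Gamma_{i+3}: d and e are in Gamma_{i+2}, while c' is in Gamma_2 and p(b) in
   Gamma_{i+1}. *)
have -> : p.1 e ** inv e = (c' ** comm a d ** inv c') **
     comm (c' ** d) e ** (e ** comm c' (p.1 b) ** inv e).
  rewrite /e (hom_comm HG HG p1) /c' /d /Defs.comm.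
  by rewrite !(gE HG).
apply: gamM; first apply: gamM.
- by apply: gamJ; apply: gam_comm.
- exact: gam_comm.
- apply: gamJ; apply: (@gam_comm_add 2 i.+1) => //; first exact: h.
  exact: gam_hom.
Qed.

End Andreadakis.

(** * A Magnus-type representation on series without repeated letters *)

Section Magnus.
Variable n : nat.
Local Notation word := (seq 'I_n).
(** Coefficient functions on all words: the vanishing of repeated letters is built into the
    operators [sX], not into the type. *)
Definition ser := word -> Z.

Definition sadd (f h : ser) : ser := fun m => (f m + h m)%Z.
Definition ssub (f h : ser) : ser := fun m => (f m - h m)%Z.
Definition sdelta : ser := fun m => if m is [::] then 1%Z else 0%Z.

(* Left multiplication by X_i in the algebra where words with a repeated letter vanish. *)
Definition sX (i : 'I_n) (f : ser) : ser := fun m =>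
  if m is k :: m' then if (k == i) && (i \notin m') then f m' else 0%Z else 0%Z.

Lemma ser_eq (f h : ser) : f =1 h -> f = h.
Proof. by move=> e; apply: functional_extensionality. Qed.

Lemma sX_add i f h : sX i (sadd f h) = sadd (sX i f) (sX i h).
Proof. by apply: ser_eq => -[|k m] //; rewrite /sX /sadd; case: ifP. Qed.

Definition ctn (s : 'I_n) (f : ser) := forall m, s \notin m -> f m = 0%Z.

Lemma sX_ctn s f : ctn s (sX s f).
Proof. by move=> [|k m] //=; rewrite inE negb_or eq_sym => /andP[/negPf ->]. Qed.

(** Prefixing X_s would repeat the letter s. This is the source of X_s W X_s = 0 for every W that
    preserves [ctn s]. *)
Lemma sX_ctn0 s f : ctn s f -> sX s f = (fun=> 0%Z).
Proof.
move=> cf; apply: ser_eq => -[|k m] //=.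
by case: ifP => // /andP[_ sm]; exact: cf.
Qed.

Definition additive (p : ser -> ser) := forall f h, p (sadd f h) = sadd (p f) (p h).

(** Additive bijections packed with their inverses, so that they form a group to which the universal
    property of RF_n applies. *)
Record linb := Linb {
  lf : ser -> ser; lg : ser -> ser; lf_add : additive lf;
  lfK : forall f, lg (lf f) = f; lgK : forall f, lf (lg f) = f }.

Lemma lg_add a : additive (lg a).
Proof. by move=> f h; rewrite -{1}(lgK a f) -{1}(lgK a h) -lf_add lfK. Qed.

Lemma linb_eq a b : (forall f, lf a f = lf b f) -> a = b.
Proof.
case: a b => [f g fA fK gK] [f' g' fA' fK' gK'] /= e.
have {}e : f = f' by apply: functional_extensionality.
subst f'.
have e' : g = g' by apply: functional_extensionality => h; rewrite -{1}(gK' h) fK.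
by subst g'; congr Linb; exact: proof_irrelevance.
Qed.

Definition linb_one : linb := @Linb id id (fun _ _ => erefl) (fun _ => erefl) (fun _ => erefl).
Definition linb_inv a : linb := Linb (lg_add a) (lgK a) (lfK a).
Definition linb_mul (a b : linb) : linb.
Proof.
refine (@Linb (fun f => lf a (lf b f)) (fun f => lg b (lg a f)) _ _ _).
- by move=> f h; rewrite !lf_add.
- by move=> f; rewrite !lfK.
- by move=> f; rewrite !lgK.
Defined.

Lemma linb_group : is_group linb_mul linb_inv linb_one.
Proof.
split; move=> *; apply: linb_eq => f //=; by rewrite ?lfK ?lgK.
Qed.

Lemma sXX i f m : sX i (sX i f) m = 0%Z.
Proof. by rewrite sX_ctn0 //; exact: sX_ctn. Qed.
Lemma sX_addE i f h m : sX i (sadd f h) m = (sX i f m + sX i h m)%Z.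
Proof. by rewrite sX_add. Qed.
Lemma sX_subE i f h m : sX i (ssub f h) m = (sX i f m - sX i h m)%Z.
Proof. by case: m => [|k m] //=; rewrite /ssub; case: ifP. Qed.

(** Left multiplication by 1 + X_i, with inverse 1 - X_i because X_i^2 = 0. *)
Definition linb_gen (i : 'I_n) : linb.
Proof.
refine (@Linb (fun f => sadd f (sX i f)) (fun f => ssub f (sX i f)) _ _ _).
- abstract by move=> f h; apply: ser_eq => m; rewrite sX_add /sadd; lia.
- abstract by move=> f; apply: ser_eq => m; rewrite {1}/ssub sX_addE sXX /sadd; lia.
- abstract by move=> f; apply: ser_eq => m; rewrite {1}/sadd sX_subE sXX /ssub; lia.
Defined.

Definition sclosed (P : ser -> Prop) :=
  (forall f h, P f -> P h -> P (sadd f h)) /\ (forall f h, P f -> P h -> P (ssub f h)).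

Lemma ctn_sclosed s : sclosed (ctn s).
Proof. by split=> f h cf ch m sm; rewrite /sadd /ssub cf ?ch. Qed.
Lemma sX_ctn_stable s i f : ctn s f -> ctn s (sX i f).
Proof.
move=> cf [|k m] //=; rewrite inE negb_or => /andP[_ sm].
by case: ifP => // _; exact: cf.
Qed.

Lemma linb_stable (P : ser -> Prop) w :
  sclosed P -> (forall i f, P f -> P (sX i f)) ->
  gen linb_mul linb_inv linb_one (fun z => exists k, z = linb_gen k) w ->
  (forall f, P f -> P (lf w f)) /\ (forall f, P f -> P (lg w f)).
Proof.
move=> [PA PB] PX; move: w; apply: gen_ind => //.
- move=> a b [fa ga] [fb gb]; split=> f pf /=; auto.
- by move=> a [fa ga]; split.
- move=> _ [k ->]; split=> f pf /=; auto.
Qed.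

(** The two orders of multiplying 1 + X_i and 1 + W^-1 X_i W differ only in the terms X_i W^-1 X_i W
    and W^-1 X_i W X_i. Both vanish, since W and W^-1 preserve [ctn i]. *)
Lemma linb_rf : rf_relations linb_mul linb_inv linb_one linb_gen.
Proof.
move=> i w gw; apply: (commute_comm1 linb_group).
have [wf wg] := linb_stable (ctn_sclosed i) (@sX_ctn_stable i) gw.
apply: linb_eq => f; rewrite /Defs.conj /=.
set X := sX i; set W := lf w; set W' := lg w.
have WA : additive W := lf_add w.
have W'A : additive W' := lg_add w.
have XWX h : X (W (X h)) = (fun=> 0%Z) by apply: sX_ctn0; apply: wf; apply: sX_ctn.
have XW'X h : X (W' (X h)) = (fun=> 0%Z) by apply: sX_ctn0; apply: wg; apply: sX_ctn.
have WK h : W' (W h) = h := lfK w h.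
rewrite !WA !W'A !WK /X !sX_add -/X.
rewrite XWX XW'X; apply: ser_eq => m.
have -> : sadd (X (W f)) (fun=> 0%Z) = X (W f).
  by apply: ser_eq => m'; rewrite /sadd Z.add_0_r.
rewrite /sadd; lia.
Qed.
End Magnus.

(** * The reduced free group: normal closures of generators and brackets *)

Section ReducedFree.
Variables (n : nat) (G : Type) (mul : G -> G -> G) (inv : G -> G) (one : G).
Variable x : 'I_n -> G.
Hypothesis RF : is_reduced_free mul inv one x.
Local Notation "a ** b" := (mul a b) (at level 40, left associativity).
Local Notation comm := (comm mul inv).
Local Notation conj := (conj mul inv).
Local Notation gen := (gen mul inv one).
Local Notation Gam := (lcs mul inv one (fun _ => True)).
Local Notation word := (seq 'I_n).

Lemma rf_group : is_group mul inv one. Proof. by case: RF. Qed.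
Local Notation HG := rf_group.
Lemma rf_gen g : gen (fun z => exists k, z = x k) g. Proof. by case: RF. Qed.
Lemma rf_rel : rf_relations mul inv one x. Proof. by case: RF. Qed.

Lemma rf_hom_ex (H : Type) (mulH : H -> H -> H) (invH : H -> H) (oneH : H) y :
  is_group mulH invH oneH -> rf_relations mulH invH oneH y ->
  exists phi : G -> H, is_hom mul mulH phi /\ forall k, phi (x k) = y k.
Proof. by case: RF => _ _ _ U gH rH; case: (U _ _ _ _ y gH rH). Qed.

Lemma rf_hom_eq (phi psi : G -> G) :
  is_hom mul mul phi -> is_hom mul mul psi ->
  (forall k, phi (x k) = psi (x k)) -> forall g, phi g = psi g.
Proof.
move=> hp hq e g; move: g (rf_gen g); apply: gen_ind.
- by rewrite (hom1 HG HG hp) (hom1 HG HG hq).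
- by move=> a b ha hb; rewrite hp hq ha hb.
- by move=> a ha; rewrite (homV HG HG hp) (homV HG HG hq) ha.
- by move=> _ [k ->]; exact: e.
Qed.

Definition ncl s := gen (fun z => exists w, z = w ** x s ** inv w).

Lemma nclJ s w u : ncl s u -> ncl s (w ** u ** inv w).
Proof.
apply: gen_conj => [|_ [v ->]]; first exact: HG.
apply: gen_mem; exists (w ** v); by rewrite !(gE HG).
Qed.
Lemma ncl_x s : ncl s (x s).
Proof. by apply: gen_mem; exists one; rewrite !(gE HG). Qed.

Lemma x_commute_conj s w : x s ** (w ** x s ** inv w) = (w ** x s ** inv w) ** x s.
Proof.
have := comm1_commute HG (rf_rel s (rf_gen (inv w))).
by rewrite /Defs.conj !(gE HG).
Qed.

(** The normal closure of x_s is abelian: conjugating the defining relation by a shows that any two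
    conjugates of x_s commute. *)
Lemma ncl_commute s u v : ncl s u -> ncl s v -> u ** v = v ** u.
Proof.
apply: (gen_commute HG) => _ _ [a ->] [b ->].
have := congr1 (fun g => a ** g ** inv a) (x_commute_conj s (inv a ** b)).
by rewrite !(gE HG).
Qed.

Lemma ncl_comm s w u : ncl s u -> ncl s (comm w u).
Proof.
move=> nu; have -> : comm w u = (w ** u ** inv w) ** inv u by rewrite /Defs.comm !(gE HG).
by apply: gen_mul; [exact: nclJ|exact: gen_inv].
Qed.
Lemma ncl_commr s w u : ncl s u -> ncl s (comm u w).
Proof. by move=> nu; rewrite -(commV HG); apply: gen_inv; apply: ncl_comm. Qed.

(** The right-normed bracket [x_{k1}, [..., [x_{kr}, x_s]]] for m = k1 ... kr. *)
Fixpoint brk (s : 'I_n) (m : word) : G :=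
  if m is k :: m' then comm (x k) (brk s m') else x s.

Lemma brk_ncl s m : ncl s (brk s m).
Proof. by elim: m => [|k m IH] /=; [exact: ncl_x|exact: ncl_comm]. Qed.
Lemma brk_ncl_mem s m i : i \in m -> ncl i (brk s m).
Proof.
elim: m => [//|k m IH] /=; rewrite inE => /orP[/eqP ->|/IH].
- by apply: ncl_commr; exact: ncl_x.
- exact: ncl_comm.
Qed.
Lemma brk_gam s m : Gam (size m).+1 (brk s m).
Proof. by elim: m => [//|k m IH]; exact: (gam_comm (x k) IH). Qed.

(** * Subgroups generated by brackets, and the retraction killing a generator *)

Definition uword (l m : word) := uniq m && all (mem l) m.
Definition brks (s : 'I_n) (l : word) :=
  gen (fun z => exists2 m, uword l m & z = brk s m).

Lemma brks_ncl s l u : brks s l u -> ncl s u.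
Proof. by apply: gen_sub => _ [m _ ->]; exact: brk_ncl. Qed.

(** If k is s or occurs in m, the bracket lies in the abelian normal closure of x_k, so x_k commutes
    with it. Otherwise conjugation by x_k multiplies it by the longer bracket of [k :: m]. *)
Lemma brks_norm_x s l k u : k \in s :: l ->
  brks s l u -> brks s l (x k ** u ** inv (x k)) /\ brks s l (inv (x k) ** u ** x k).
Proof.
move=> kl hu.
suff C m : uword l m -> brks s l (x k ** brk s m ** inv (x k)) /\
     brks s l (inv (x k) ** brk s m ** x k).
  split; first by apply: (gen_conj HG) hu => _ [m /C[h _] ->].
  have -> : inv (x k) ** u ** x k = inv (x k) ** u ** inv (inv (x k)) by rewrite !(gE HG).
  by apply: (gen_conj HG) hu => _ [m /C[_ h] ->]; rewrite (ginvK HG).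
move=> um; have hm : brks s l (brk s m) by apply: gen_mem; exists m.
have commuting : ncl k (brk s m) -> brks s l (x k ** brk s m ** inv (x k)) /\
     brks s l (inv (x k) ** brk s m ** x k).
  move=> /(ncl_commute (@ncl_x k)) e.
  by rewrite e !(gE HG) -e !(gE HG).
case: (boolP (k \in m)) => km; first by apply: commuting; exact: brk_ncl_mem.
case/orP: (kl) => [/eqP ks|kl']; first by apply: commuting; rewrite ks; exact: brk_ncl.
have hkm : brks s l (brk s (k :: m)).
  by apply: gen_mem; exists (k :: m) => //; case/andP: um => u1 u2; apply/andP; split; apply/andP.
have e : x k ** brk s m ** inv (x k) = brk s (k :: m) ** brk s m.
  by rewrite /= /Defs.comm !(gE HG).
split; first by rewrite e; exact: gen_mul.
(* Since x_k also commutes with the longer bracket, conjugation by x_k^-1 multiplies by the inverse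
   of that bracket. *)
have xkm := ncl_commute (@ncl_x k) (@brk_ncl_mem s (k :: m) k (mem_head _ _)).
have -> : inv (x k) ** brk s m ** x k = inv (brk s (k :: m)) ** brk s m.
  apply: (gcancel HG (a := brk s (k :: m))); apply: (gcancel HG (a := x k)).
  rewrite [brk s (k :: m) ** (inv _ ** _)](gKV HG) -2!(gA HG) xkm.
  have -> : x k ** brk s m = x k ** brk s m ** inv (x k) ** x k by rewrite !(gE HG).
  by rewrite e !(gE HG).
by apply: gen_mul => //; exact: gen_inv.
Qed.

(** A predicate rather than a function, because the universal property yields the retraction only as
    an existential. *)
Definition kill s (r : G -> G) :=
  is_hom mul mul r /\ forall k, r (x k) = if k == s then one else x k.

Lemma kill_ex s : exists r, kill s r.
Proof.
have [|r [rM rx]] := rf_hom_ex (y := fun k => if k == s then one else x k) HG.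
  move=> i w _; case: eqP => _; first by rewrite /Defs.comm /Defs.conj !(gE HG).
  exact: rf_rel (rf_gen w).
by exists r.
Qed.

Local Notation span l := (gen (fun z => exists2 k, k \in l & z = x k)).

(** The semidirect decomposition of the subgroup on [s :: l]: the kernel part of w is a product of
    brackets, the complement is the subgroup on [l]. *)
Lemma kill_decomp s l r w : s \notin l -> kill s r -> span (s :: l) w ->
  brks s l (w ** inv (r w)) /\ span l (r w).
Proof.
move=> sl [rM rx] sw.
(* The induction also carries that w and w^-1 normalize [brks s l], needed for ab r(ab)^-1 = a (b
   r(b)^-1) a^-1 (a r(a)^-1). *)
suff [h [h1 _]] : span l (r w) /\ (brks s l (w ** inv (r w)) /\ forall u, brks s l u ->
  brks s l (w ** u ** inv w) /\ brks s l (inv w ** u ** w)) by [].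
have xs : brks s l (x s) by apply: gen_mem; exists [::].
move: w sw; apply: gen_ind.
- rewrite (hom1 HG HG rM) !(gE HG); split; first exact: gen_one.
  by split; [exact: gen_one|move=> u hu; rewrite !(gE HG)].
- move=> a b [ra [ha na]] [rb [hb nb]]; rewrite rM; split; first exact: gen_mul.
  split; last first.
    move=> u hu; split.
      by have := (na _ (nb _ hu).1).1; rewrite !(gE HG).
    by have := (nb _ (na _ hu).2).2; rewrite !(gE HG).
  have := gen_mul (na _ hb).1 ha.
  by rewrite !(gE HG).
- move=> a [ra [ha na]]; rewrite (homV HG HG rM); split; first exact: gen_inv.
  split; last by move=> u hu; rewrite (ginvK HG); case: (na _ hu).
  have := gen_inv (na _ ha).2.
  by rewrite !(gE HG).
- move=> _ [k kl ->]; split.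
    rewrite rx; case: eqP => ks; first exact: gen_one.
    by apply: gen_mem; exists k => //; move: kl; rewrite inE => /orP[/eqP|].
  split; last by move=> u; exact: brks_norm_x.
  rewrite rx; case: eqP => [->|_]; first by rewrite !(gE HG).
  by rewrite !(gE HG); exact: gen_one.
Qed.

(** * The action of RF_n on series and the degree filtration *)

Section Expansion.
Variable phi : G -> linb n.
Hypotheses (phiM : is_hom mul (@linb_mul n) phi) (phi_x : forall k, phi (x k) = linb_gen k).
Local Notation LG := (linb_group n).
(** Applied to the series 1, that is [sdelta], it gives the Magnus expansion of g. *)
Definition rho g f := lf (phi g) f.

Lemma rhoM a b f : rho (a ** b) f = rho a (rho b f).
Proof. by rewrite /rho phiM. Qed.
Lemma rho1 f : rho one f = f.
Proof. by rewrite /rho (hom1 HG LG phiM). Qed.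
Lemma rho_add g f h : rho g (sadd f h) = sadd (rho g f) (rho g h).
Proof. exact: lf_add. Qed.
Lemma sadd_subK (f h : ser n) : sadd (ssub f h) h = f.
Proof. by apply: ser_eq => m; rewrite /sadd /ssub; lia. Qed.
Lemma rho_sub g f h : rho g (ssub f h) = ssub (rho g f) (rho g h).
Proof.
rewrite -{2}(sadd_subK f h) rho_add; apply: ser_eq => m.
by rewrite /ssub /sadd; lia.
Qed.
Lemma rho_x k f : rho (x k) f = sadd f (sX k f).
Proof. by rewrite /rho phi_x. Qed.
Lemma rho_xV k f : rho (inv (x k)) f = ssub f (sX k f).
Proof. by rewrite /rho (homV HG LG phiM) phi_x. Qed.

Lemma rho_stable (P : ser n -> Prop) g f :
  sclosed P -> (forall i f, P f -> P (sX i f)) -> P f -> P (rho g f).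
Proof.
move=> Pc PX; suff /(linb_stable Pc PX)[h _] :
  Defs.gen (@linb_mul n) (@linb_inv n) (linb_one n)
    (fun z => exists k, z = linb_gen k) (phi g) by exact: h.
apply: (hom_gen HG LG phiM) (rf_gen g) => _ [k ->].
by apply: gen_mem; exists k; exact: phi_x.
Qed.

Definition deg t (f : ser n) := forall m, size m < t -> f m = 0%Z.
Lemma deg_sclosed t : sclosed (deg t).
Proof. by split=> f h cf ch m sm; rewrite /sadd /ssub cf ?ch. Qed.
Lemma sX_deg t i f : deg t f -> deg t.+1 (sX i f).
Proof. by move=> df [|k m] //= sm; case: ifP => // _; apply: df. Qed.
Lemma deg_le t u f : t <= u -> deg u f -> deg t f.
Proof. by move=> tu df m mt; apply: df; exact: leq_trans tu. Qed.
Lemma rho_deg t g f : deg t f -> deg t (rho g f).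
Proof.
apply: (@rho_stable (deg t)) => [|i h dh]; first exact: deg_sclosed.
by apply: (deg_le (leqnSn t)); exact: sX_deg.
Qed.

(** Plays the role of the left ideal generated by X_i, hence is stable under the action. *)
Definition ends i (f : ser n) :=
  f [::] = 0%Z /\ forall m k, k != i -> f (rcons m k) = 0%Z.
Lemma rho_ends i g f : ends i f -> ends i (rho g f).
Proof.
apply: (@rho_stable (ends i)).
- split=> p q [p1 p2] [q1 q2]; split=> *; rewrite /sadd /ssub ?p1 ?q1 //;
  by rewrite p2 ?q2.
- move=> j h [h1 h2]; split=> // -[|a m] k ki /=; first by case: ifP.
  by case: ifP => // _; exact: h2.
Qed.
Lemma sX_delta_ends i : ends i (sX i (@sdelta n)).
Proof.
split=> // -[|a m] k ki /=; first by rewrite (negPf ki).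
by case: ifP => // _; case: m.
Qed.

Lemma rho_ctn s g f : ctn s f -> ctn s (rho g f).
Proof. by apply: (@rho_stable (ctn s)); [exact: ctn_sclosed|exact: sX_ctn_stable]. Qed.

(** Operator form of: g acts as 1 + (degree >= j). Quantifying over t lets such operators be
    composed. *)
Definition raises j g := forall t f, deg t f -> deg (t + j) (ssub (rho g f) f).

Lemma raises_one j : raises j one.
Proof. by move=> t f df m _; rewrite /ssub rho1 Z.sub_diag. Qed.
Lemma raises_mul j a b : raises j a -> raises j b -> raises j (a ** b).
Proof.
move=> ha hb t f df m mt; rewrite /ssub rhoM.
have := ha t _ (rho_deg b df) m mt; have := hb t f df m mt.
by rewrite /ssub; lia.
Qed.
Lemma raises_inv j a : raises j a -> raises j (inv a).
Proof.
move=> ha t f df m mt.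
have := rho_deg (inv a) (ha t f df) mt.
by rewrite rho_sub -rhoM (mulVg HG) rho1 /ssub; lia.
Qed.
Lemma raises_comm i j a b : raises i a -> raises j b -> raises (i + j) (comm a b).
Proof.
move=> ha hb t f df m mt.
(* Writing f = ba h gives [a, b] f - f = ab h - ba h = (a-1)(b-1) h - (b-1)(a-1) h. *)
pose h := rho (inv a ** inv b) f.
have dh : deg t h by exact: rho_deg.
have -> : f = rho (b ** a) h by rewrite -rhoM !(gE HG) rho1.
have -> : rho (comm a b) (rho (b ** a) h) = rho (a ** b) h.
  by rewrite -rhoM /Defs.comm !(gE HG).
have := ha _ _ (hb t h dh) m; have := hb _ _ (ha t h dh) m.
have -> : t + i + j = t + (i + j) by lia.
have -> : t + j + i = t + (i + j) by lia.
move=> /(_ mt) + /(_ mt); rewrite !rho_sub /ssub !rhoM; lia.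
Qed.

Lemma raises_gen j (S : G -> Prop) g :
  (forall a, S a -> raises j a) -> gen S g -> raises j g.
Proof.
move=> hS; move: g; apply: gen_ind => //; [exact: raises_one|exact: raises_mul|].
exact: raises_inv.
Qed.

Lemma gam_raises j g : Gam j.+1 g -> raises j.+1 g.
Proof.
have raises1 h : raises 1 h.
  apply: raises_gen (rf_gen h) => _ [k ->] t f df m mt.
  by rewrite rho_x /sadd /ssub addn1 in mt *; rewrite (sX_deg k df mt); lia.
elim: j g => [|j IH] g; first by move=> _; exact: raises1.
rewrite lcsS; apply: raises_gen => _ [a [b [_ [gb ->]]]].
by rewrite -[j.+2]add1n; apply: raises_comm => //; exact: IH.
Qed.

(** * Reading off coefficients of expansions *)

Local Notation delta := (@sdelta n).

(** Compare coefficients of X_i m in x_i w = w g x_i, with g = x_i^w x_i^-1. The left side gives w(i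
    m) + w(m). The right side gives only w(i m): g - 1 contributes nothing in degree at most j, and
    a final factor X_i produces words ending in i, whereas m is nonempty and avoids i. *)
Lemma coef_of_comm_gam j i w : Gam j.+1 (conj (x i) w ** inv (x i)) ->
  forall m : word, i \notin m -> m != [::] -> size m < j -> rho w delta m = 0%Z.
Proof.
move=> gg m im m0 mj.
have e : x i ** w = w ** (conj (x i) w ** inv (x i)) ** x i.
  by rewrite /Defs.conj !(gE HG).
move: (conj _ _ ** _) gg e => g gg e.
have := congr1 (fun g => rho g delta (i :: m)) e; rewrite /= !rhoM !rho_x.
rewrite {1}/sadd /= eqxx im /=.
set d0 := sadd delta (sX i delta).
have d00 : deg 0 d0 by [].
have dd := gam_raises gg d00; rewrite add0n in dd.
have -> : rho g d0 = sadd d0 (ssub (rho g d0) d0).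
  by apply: ser_eq => m'; rewrite /sadd /ssub; lia.
rewrite rho_add {1}/sadd (rho_deg w dd) // /d0 rho_add /sadd.
have [_ he] := rho_ends w (sX_delta_ends i).
have -> : rho w (sX i delta) (i :: m) = 0%Z.
  case: (lastP m) m0 im => [//|m' k] _; rewrite mem_rcons inE negb_or eq_sym => /andP[ki _].
  by rewrite -rcons_cons he.
lia.
Qed.

(** For u = w x_s w^-1 the operator u - 1 is w X_s w^-1: its values have s in every word, and it
    kills series that already do. *)
Lemma ncl_rho s u : ncl s u ->
  (forall f, ctn s (ssub (rho u f) f)) /\ (forall f, ctn s f -> rho u f = f).
Proof.
move: u; apply: gen_ind.
- split=> [f m _|f _]; rewrite rho1 //; by rewrite /ssub; lia.
- move=> a b [a1 a2] [b1 b2]; split=> [f m sm|f cf]; last by rewrite rhoM b2 ?a2.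
  by have := a1 (rho b f) m sm; have := b1 f m sm; rewrite /ssub rhoM; lia.
- move=> a [a1 a2]; split=> [f m sm|f cf].
    have := rho_ctn (inv a) (a1 f) sm.
    by rewrite rho_sub -rhoM (mulVg HG) rho1 /ssub; lia.
  by rewrite -{1}(a2 f cf) -rhoM (mulVg HG) rho1.
- move=> _ [w ->].
  have key f : rho (w ** x s ** inv w) f = sadd f (rho w (sX s (rho (inv w) f))).
    by rewrite !rhoM rho_x rho_add -rhoM (mulgV HG) rho1.
  split=> [f m sm|f cf]; rewrite key.
    by have := rho_ctn w (@sX_ctn n s (rho (inv w) f)) sm; rewrite /ssub /sadd; lia.
  rewrite sX_ctn0; last exact: rho_ctn.
  have -> : (fun=> 0%Z) = ssub f f by apply: ser_eq => m; rewrite /ssub; lia.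
  by rewrite rho_sub; apply: ser_eq => m; rewrite /sadd /ssub; lia.
Qed.

(* Additive on the normal closure of [x s], and dual to the brackets [brk s m]. *)
Definition cf s u m := rho u delta (rcons m s).

(** In uv - 1 = (u-1) + (v-1) + (u-1)(v-1) the last product vanishes by [ncl_rho]. *)
Lemma cf_mul s u v m : ncl s u -> ncl s v -> cf s (u ** v) m = (cf s u m + cf s v m)%Z.
Proof.
move=> /ncl_rho[u1 u2] /ncl_rho[v1 v2]; rewrite /cf rhoM.
have -> : rho v delta = sadd delta (ssub (rho v delta) delta).
  by apply: ser_eq => m'; rewrite /sadd /ssub; lia.
rewrite rho_add (u2 _ (v1 delta)) /sadd /ssub.
have -> : delta (rcons m s) = 0%Z by case: m.
lia.
Qed.
Lemma cf1 s m : cf s one m = 0%Z.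
Proof. by rewrite /cf rho1; case: m. Qed.
Lemma cfV s u m : ncl s u -> cf s (inv u) m = (- cf s u m)%Z.
Proof.
move=> nu; have := cf_mul m nu (gen_inv nu); rewrite (mulgV HG) cf1; lia.
Qed.

Lemma cf_x s m : cf s (x s) m = if m is [::] then 1%Z else 0%Z.
Proof.
rewrite /cf rho_x /sadd; case: m => [|a m] /=; first by rewrite eqxx.
by case: ifP => // _; case: m.
Qed.

(** In (1 + X_k) u (1 - X_k), terms with X_k on the right end in k, not s. At words ending in s only
    u + X_k u remains, and the factor u^-1 cancels u. *)
Lemma cf_comm s k u m : k != s -> ncl s u ->
  cf s (comm (x k) u) m =
  if m is a :: m' then (if (a == k) && (k \notin m') then cf s u m' else 0%Z) else 0%Z.
Proof.
move=> ks nu.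
have -> : comm (x k) u = x k ** u ** inv (x k) ** inv u by rewrite /Defs.comm !(gE HG).
rewrite cf_mul; [|exact: nclJ|exact: gen_inv].
rewrite cfV // /cf !rhoM rho_xV rho_sub rho_x.
set z := ssub _ _.
have zE m' : z (rcons m' s) = rho u delta (rcons m' s).
  have [_ he] := rho_ends u (sX_delta_ends k).
  by rewrite /z /ssub he 1?eq_sym //; lia.
rewrite {1}/sadd zE; case: m => [|a m] /=.
  by rewrite [s == k]eq_sym (negPf ks) /=; lia.
rewrite mem_rcons inE negb_or ks /= zE; case: ifP => _; lia.
Qed.

Lemma cf_brk s m m' : uniq m' -> s \notin m' ->
  cf s (brk s m') m = if m == m' then 1%Z else 0%Z.
Proof.
elim: m' m => [|k m' IH] m /=; first by rewrite cf_x; case: m.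
move=> /andP[km um]; rewrite inE negb_or eq_sym => /andP[ks sm].
rewrite cf_comm //; last exact: brk_ncl.
case: m => [|a m] //=; rewrite eqseq_cons IH //.
case: eqP => //= _; case: eqP => [->|_]; first by rewrite km.
by rewrite if_same.
Qed.

(** * Products of commuting brackets and their exponents *)

Definition brk_prod s (a : word -> nat) (ms : seq word) : G :=
  foldr (fun m g => iter (a m) (mul (brk s m)) g) one ms.

Lemma iter_mulE e k g : iter k (mul e) g = iter k (mul e) one ** g.
Proof. by elim: k => [|k IH] /=; rewrite ?IH !(gE HG). Qed.
Lemma iter_mulD e k l : iter (k + l) (mul e) one = iter k (mul e) one ** iter l (mul e) one.
Proof. by rewrite iterD iter_mulE. Qed.
Lemma iter_ncl s e k : ncl s e -> ncl s (iter k (mul e) one).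
Proof. by move=> he; elim: k => [|k IH] /=; [exact: gen_one|exact: gen_mul]. Qed.

Lemma brk_prod_ncl s a ms : ncl s (brk_prod s a ms).
Proof.
elim: ms => [|m ms IH] /=; first exact: gen_one.
rewrite iter_mulE; apply: gen_mul => //; apply: iter_ncl; exact: brk_ncl.
Qed.

Lemma brk_prodD s a b ms :
  brk_prod s (fun m => a m + b m) ms = brk_prod s a ms ** brk_prod s b ms.
Proof.
elim: ms => [|m ms IH] /=; first by rewrite !(gE HG).
have nb c : ncl s (iter c (mul (brk s m)) one) by apply: iter_ncl; exact: brk_ncl.
rewrite ![iter _ _ (brk_prod _ _ _)]iter_mulE iter_mulE iter_mulD IH !(gE HG).
have := ncl_commute (nb (b m)) (@brk_prod_ncl s a ms).
move=> /(congr1 (fun g => g ** brk_prod s b ms)); rewrite !(gE HG) => ->.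
by [].
Qed.

Lemma brk_prod_delta s m0 ms : uniq ms -> m0 \in ms ->
  brk_prod s (fun m => m == m0) ms = brk s m0.
Proof.
have out ms' : m0 \notin ms' -> brk_prod s (fun m => m == m0) ms' = one.
  elim: ms' => [//|m ms' IH] /=; rewrite inE negb_or eq_sym => /andP[/negPf -> h] /=.
  exact: IH.
elim: ms => [//|m ms IH] /= /andP[mms ums]; rewrite inE.
case: (eqVneq m0 m) => [e _|_ /= h]; last exact: IH.
by rewrite out ?e //= !(gE HG).
Qed.

Lemma brk_prod_cf s a ms m : uniq ms -> (forall m', m' \in ms -> uniq m' && (s \notin m')) ->
  m \in ms -> cf s (brk_prod s a ms) m = Z.of_nat (a m).
Proof.
move=> + hms mms; suff cfE : uniq ms ->
  cf s (brk_prod s a ms) m = if m \in ms then Z.of_nat (a m) else 0%Z.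
  by move/cfE; rewrite mms.
elim: ms {mms} hms => [|m' ms IH] hms /=; first by rewrite cf1.
move=> /andP[m'ms ums]; have /andP[um' sm'] := hms m' (mem_head _ _).
have nb := @brk_ncl s m'.
have {}IH : cf s (brk_prod s a ms) m = if m \in ms then Z.of_nat (a m) else 0%Z.
  by apply: IH => // m'' h; apply: hms; rewrite inE h orbT.
rewrite iter_mulE cf_mul; [|exact: iter_ncl|exact: brk_prod_ncl].
have -> k : cf s (iter k (mul (brk s m')) one) m = if m == m' then Z.of_nat k else 0%Z.
  elim: k => [|k IHk]; first by rewrite /= cf1 if_same.
  rewrite iterS cf_mul ?IHk //; last exact: iter_ncl.
  by rewrite cf_brk //; case: eqP => // _; lia.
rewrite IH inE; case: eqP => [->|_] //=; rewrite (negPf m'ms); lia.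
Qed.

Lemma brk_prod_gam j s a b ms :
  (forall m, m \in ms -> (size m).+1 < j -> a m = b m) ->
  Gam j (brk_prod s a ms ** inv (brk_prod s b ms)).
Proof.
elim: ms => [|m ms IH] hab /=; first by rewrite !(gE HG); exact: gam1.
have {}IH : Gam j (brk_prod s a ms ** inv (brk_prod s b ms)).
  by apply: IH => m' h; apply: hab; rewrite inE h orbT.
rewrite ![iter _ _ (brk_prod _ _ _)]iter_mulE.
set e := iter (a m) _ _; set f := iter (b m) _ _.
have -> : e ** brk_prod s a ms ** inv (f ** brk_prod s b ms) =
  e ** (brk_prod s a ms ** inv (brk_prod s b ms)) ** inv e ** (e ** inv f).
  by rewrite !(gE HG).
apply: gamM; first exact: (gamJ HG).
(* The bracket of m has weight [(size m).+1], one more than the length of m: below j the exponents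
   agree, from j on both powers lie in Gamma_j. *)
case: (leqP j (size m).+1) => [jm|mj]; last first.
  by rewrite /e /f (hab m (mem_head _ _) mj) !(gE HG); exact: gam1.
have h c : Gam j (iter c (mul (brk s m)) one).
  elim: c => [|c IHc]; first exact: gam1.
  by apply: gamM => //; apply: (gam_dec jm); exact: brk_gam.
by apply: gamM; [exact: h|apply: gamV; exact: h].
Qed.

(** A word without repetition has length at most n, so it is found in the finite type of sequences
    of length at most n. *)
Lemma uwords_enum (l : word) : exists2 ms : seq word, uniq ms & forall m, (m \in ms) = uword l m.
Proof.
exists (filter (uword l) [seq val t | t <- enum {: n.-bseq 'I_n}]).
  by rewrite filter_uniq // map_inj_uniq ?enum_uniq //; exact: val_inj.
move=> m; rewrite mem_filter; case: (boolP (uword l m)) => //= /andP[um _].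
have sm : size m <= n.
  by rewrite -[X in _ <= X](card_ord n) -(card_uniqP um) max_card.
by apply/mapP; exists (Bseq sm) => //; rewrite mem_enum.
Qed.

(** Exponents are natural numbers, so u is expressed as a quotient of two products. As all factors
    commute, multiplying adds exponents and inverting swaps a and b. *)
Lemma brks_prod s l ms u : uniq ms -> (forall m, (m \in ms) = uword l m) ->
  brks s l u -> exists a b, u ** brk_prod s b ms = brk_prod s a ms.
Proof.
move=> ums hms hu; suff [] : brks s l u /\
  exists a b, u ** brk_prod s b ms = brk_prod s a ms by [].
have cm v a : brks s l v -> v ** brk_prod s a ms = brk_prod s a ms ** v.
  by move/brks_ncl => nv; apply: ncl_commute nv _; exact: brk_prod_ncl.
move: u hu; apply: gen_ind.
- split; first exact: gen_one.
  by exists (fun=> 0), (fun=> 0); rewrite !(gE HG).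
- move=> u v [hu [a [b ea]]] [hv [c [d ec]]]; split; first exact: gen_mul.
  exists (fun m => a m + c m), (fun m => b m + d m); rewrite !brk_prodD -ea -ec.
  have := congr1 (fun g => u ** g ** brk_prod s d ms) (cm v b hv).
  by rewrite !(gE HG).
- move=> u [hu [a [b e]]]; split; first exact: gen_inv.
  by exists b, a; rewrite -e !(gE HG).
- move=> _ [m um ->]; split; first by apply: gen_mem; exists m.
  exists (fun m' => m' == m), (fun=> 0); rewrite brk_prod_delta ?hms //.
  suff -> : brk_prod s (fun=> 0) ms = one by rewrite !(gE HG).
  by elim: (ms).
Qed.

(** By duality [cf s u m] is a(m) - b(m), so vanishing coefficients make the exponents of the two
    products agree in weight below j. *)
Lemma brks_gam j s l u : s \notin l -> brks s l u ->
  (forall m, uword l m -> (size m).+1 < j -> cf s u m = 0%Z) -> Gam j u.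
Proof.
move=> sl hu cu; have [ms ums hms] := uwords_enum l.
have [a [b e]] := brks_prod ums hms hu.
have nu := brks_ncl hu.
have hms' m : m \in ms -> uniq m && (s \notin m).
  by rewrite hms => /andP[-> /allP am]; apply: contra sl => /am.
have -> : u = brk_prod s a ms ** inv (brk_prod s b ms) by rewrite -e !(gE HG).
apply: brk_prod_gam => m mms mj.
have := congr1 (fun g => cf s g m) e.
rewrite cf_mul ?cu -?hms //; last exact: brk_prod_ncl.
by rewrite !brk_prod_cf //; lia.
Qed.

Lemma gam_of_coef j l w : uniq l -> span l w ->
  (forall m, uword l m -> m != [::] -> size m < j.+1 -> rho w delta m = 0%Z) -> Gam j.+1 w.
Proof.
elim: l w => [|s l IH] w.
  move=> _ hw _; suff -> : w = one by exact: gam1.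
  move: w hw; apply: gen_ind => //; last by move=> a [].
  - by move=> a b -> ->; rewrite !(gE HG).
  - by move=> a ->; rewrite !(gE HG).
move=> /andP[sl ul] hw hc; have [r kr] := kill_ex s.
have [hu hr] := kill_decomp sl kr hw.
set u := w ** inv (r w) in hu; set w' := r w in hr hu *.
have ew : w = u ** w' by rewrite /u !(gE HG).
have [u1 u2] := ncl_rho (brks_ncl hu).
have wide m : uword l m -> uword (s :: l) m.
  case/andP=> um /allP am; rewrite /uword um; apply/allP => k /am kl.
  by rewrite inE; apply/orP; right.
have gw' : Gam j.+1 w'.
  (* The factor u changes only coefficients of words containing s, so w' and w agree on words in
     l. *)
  apply: IH => // m um m0 mj.
  have sm : s \notin m by case/andP: um => _ /allP am; apply: contra sl => /am.
  have := hc m (wide m um) m0 mj; rewrite ew rhoM.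
  by have := u1 (rho w' delta) m sm; rewrite /ssub; lia.
rewrite ew; apply: gamM => //; apply: brks_gam hu _ => // m um mj.
have sm : s \notin m by case/andP: um => _ /allP am; apply: contra sl => /am.
have ums : uword (s :: l) (rcons m s).
  have /andP[u3 u4] := wide m um; rewrite /uword rcons_uniq sm u3 /= all_rcons u4.
  by rewrite andbT; exact: mem_head.
have := hc (rcons m s) ums; rewrite size_rcons => /(_ _ mj).
have -> : rcons m s != [::] by case: (m).
move=> /(_ isT); rewrite ew rhoM /cf.
(* Since w' now acts as 1 + (degree >= j+1), u and w have the same coefficients in degree at most
   j. *)
have d0 : deg 0 delta by [].
have := rho_deg u (gam_raises gw' d0) (m := rcons m s).
by rewrite size_rcons add0n => /(_ mj); rewrite rho_sub /ssub; lia.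
Qed.

Lemma gam_of_comm_gam j i l w : uniq l -> i \notin l -> span l w ->
  Gam j.+2 (conj (x i) w ** inv (x i)) -> Gam j.+1 w.
Proof.
move=> ul il sw gw; apply: gam_of_coef ul sw _ => m um m0 mj.
apply: coef_of_comm_gam gw _ _ m0 mj.
by case/andP: um => _ /allP am; apply: contra il => /am.
Qed.
End Expansion.

(** * Conjugators of x_i that avoid x_i *)

Definition others i := [seq k <- enum 'I_n | k != i].
Lemma others_uniq i : uniq (others i).
Proof. by rewrite filter_uniq ?enum_uniq. Qed.
Lemma mem_others i k : (k \in others i) = (k != i).
Proof. by rewrite mem_filter mem_enum andbT. Qed.
Lemma notin_others i : i \notin others i.
Proof. by rewrite mem_others eqxx. Qed.
Lemma span_all i g : span (i :: others i) g.
Proof.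
apply: gen_sub (rf_gen g) => _ [k ->]; apply: gen_mem; exists k => //.
by rewrite inE mem_others; case: eqP.
Qed.

Lemma kill_span i r g : kill i r -> span (others i) (r g).
Proof. by move=> kr; case: (kill_decomp (notin_others i) kr (@span_all i g)). Qed.

(** The factor w r(w)^-1 lies in the abelian normal closure of x_i and so commutes with x_i. *)
Lemma kill_conj i r w : kill i r -> conj (x i) (r w) = conj (x i) w.
Proof.
move=> kr; have [/brks_ncl hu _] := kill_decomp (notin_others i) kr (@span_all i w).
have e := ncl_commute hu (@ncl_x i).
have {2}-> : w = (w ** inv (r w)) ** r w by rewrite !(gE HG).
set u := w ** inv (r w) in e *; set v := r w.
have -> : conj (x i) (u ** v) = inv v ** inv u ** (x i ** u) ** v.
  by rewrite /Defs.conj !(gE HG).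
by rewrite -e /Defs.conj !(gE HG).
Qed.

Lemma gam_of_conj i r j w : kill i r ->
  Gam j.+2 (conj (x i) w ** inv (x i)) -> Gam j.+1 (r w).
Proof.
move=> kr; rewrite -(kill_conj w kr).
have [phi [phiM phi_x]] := rf_hom_ex (linb_group n) (@linb_rf n).
apply: (gam_of_comm_gam phiM phi_x) (@kill_span _ _ w kr); first exact: others_uniq.
exact: notin_others.
Qed.

(** * The group of automorphisms conjugating each generator *)

Local Notation hPS := (hPSigma mul inv x).
Local Notation A := (andreadakis mul inv one).
Local Notation GamPS := (lcs (@aut_mul G) (@aut_inv G) (@aut_one G) hPS).

Lemma hPS_one : hPS (aut_one G).
Proof. by split; [exact: is_aut_one|move=> i; exists one; rewrite /Defs.conj !(gE HG)]. Qed.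
Lemma hPS_mul p q : hPS p -> hPS q -> hPS (aut_mul p q).
Proof.
case=> ap hp [aq hq]; split; first exact: is_aut_mul.
move=> i; have [v ev] := hq i; have [w ew] := hp i; have [pM _ _ _] := ap.
exists (w ** p.1 v); rewrite /= ev (hom_conj HG HG pM) ew /Defs.conj.
by rewrite !(gE HG).
Qed.
Lemma hPS_inv p : hPS p -> hPS (aut_inv p).
Proof.
case=> ap hp; split; first exact: is_aut_inv.
move=> i; have [w ew] := hp i; have [pM qM pK qK] := ap.
exists (inv (p.2 w)) => /=.
have := congr1 p.2 ew; rewrite qK (hom_conj HG HG qM) => {2}->.
by rewrite /Defs.conj !(gE HG).
Qed.

Lemma hPS_andr1 p : hPS p -> A 1 p.
Proof.
case=> ap hp; apply: (andr1_of_abelianization HG ap) => g; have [pM _ _ _] := ap.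
apply: (gen_fixed_mod HG pM) (rf_gen g) => _ [i ->]; have [w ->] := hp i.
have -> : conj (x i) w ** inv (x i) = comm (inv w) (x i).
  by rewrite /Defs.conj /Defs.comm !(gE HG).
exact: gam_comm.
Qed.

Lemma lcs_hPS_andr j p : GamPS j.+1 p -> A j.+1 p.
Proof.
elim: j p => [|j IH] p; first exact: hPS_andr1.
rewrite lcsS; move: p; apply: gen_ind.
- exact: (andr_one HG).
- by move=> a b; apply: (andr_mul HG).
- by move=> a; apply: (andr_inv HG).
- move=> _ [a [b [ha [hb ->]]]]; rewrite -[j.+2]add1n; apply: (andr_comm HG) => //.
    exact: hPS_andr1.
  exact: IH.
Qed.

(** * Twists of a single generator *)

Definition is_twist i v (p : autT G) := [/\ is_aut mul p, p.1 (x i) = conj (x i) v &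
  forall k, k != i -> p.1 (x k) = x k].

Lemma twist_fix i v p u : is_twist i v p -> span (others i) u -> p.1 u = u.
Proof.
case=> [[pM _ _ _] _ px] su; suff [] : span (others i) u /\ p.1 u = u by [].
move: u su; apply: gen_ind.
- by rewrite (hom1 HG HG pM); split => //; exact: gen_one.
- by move=> a b [sa ea] [sb eb]; rewrite pM ea eb; split => //; exact: gen_mul.
- by move=> a [sa ea]; rewrite (homV HG HG pM) ea; split => //; exact: gen_inv.
- move=> _ [k kl ->]; rewrite px -?mem_others //; split => //.
  by apply: gen_mem; exists k.
Qed.

(** The relations survive because x_i^v and its conjugates stay in the abelian normal closure of
    x_i. *)
Lemma twist_hom i v : exists f, [/\ is_hom mul mul f, f (x i) = conj (x i) v &
  forall k, k != i -> f (x k) = x k].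
Proof.
have xconj k w w' : comm (conj (x k) w') (conj (conj (x k) w') w) = one.
  apply: (commute_comm1 HG); apply: (@ncl_commute k).
    by apply: gen_mem; exists (inv w'); rewrite /Defs.conj (ginvK HG).
  apply: gen_mem; exists (inv w ** inv w'); by rewrite /Defs.conj !(gE HG).
have [|f [fM fx]] := rf_hom_ex (y := fun k => if k == i then conj (x i) v else x k) HG.
  move=> k w _; case: eqP => _; first exact: xconj.
  exact: rf_rel (rf_gen w).
by exists f; split=> // [|k /negPf ki]; rewrite fx ?eqxx ?ki.
Qed.

(** The inverse is the twist by v^-1: both maps fix v, which avoids x_i. *)
Lemma twist_ex i v : span (others i) v -> exists p, is_twist i v p.
Proof.
move=> sv; have [f [fM fx fo]] := twist_hom i v.
have [g [gM gx go]] := twist_hom i (inv v).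
have fixv h : is_hom mul mul h -> (forall k, k != i -> h (x k) = x k) -> h v = v.
  move=> hM ho; apply: (gen_ind (P := fun u => h u = u)) sv.
  - exact: (hom1 HG HG hM).
  - by move=> a b ea eb; rewrite hM ea eb.
  - by move=> a ea; rewrite (homV HG HG hM) ea.
  - by move=> _ [k kl ->]; rewrite ho -?mem_others.
have cancel a b w : is_hom mul mul a -> is_hom mul mul b ->
   a (x i) = conj (x i) w -> b (x i) = conj (x i) (inv w) ->
   (forall k, k != i -> a (x k) = x k) -> (forall k, k != i -> b (x k) = x k) ->
   a w = w -> forall u, a (b u) = u.
  move=> aM bM ax bx ao bo aw; apply: (@rf_hom_eq (fun u => a (b u)) id) => //.
    by move=> u u'; rewrite bM aM.
  move=> k; case: (eqVneq k i) => [->|ki]; last by rewrite bo ?ao.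
  by rewrite bx (hom_conj HG HG aM) (homV HG HG aM) ax aw /Defs.conj !(gE HG).
exists (f, g); split => //; split=> //=.
- by apply: (cancel _ _ v) => //; exact: fixv.
- apply: (cancel _ _ (inv v)) => //; first by rewrite (ginvK HG).
  by rewrite (homV HG HG gM) fixv.
Qed.

Lemma twist_eq i v p q : is_twist i v p -> is_twist i v q -> p = q.
Proof.
case=> ap px po [aq qx qo]; apply: (aut_eq ap aq); have [pM _ _ _] := ap.
have [qM _ _ _] := aq; apply: rf_hom_eq => // k.
by case: (eqVneq k i) => [->|ki]; rewrite ?px ?qx // po ?qo.
Qed.

Lemma twist_mul i v w p q : span (others i) w -> is_twist i v p -> is_twist i w q ->
  is_twist i (v ** w) (aut_mul p q).
Proof.
move=> sw tp tq; have pw := twist_fix tp sw.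
case: tp tq => ap px po [aq qx qo]; have [pM _ _ _] := ap; split.
- exact: is_aut_mul.
- by rewrite /= qx (hom_conj HG HG pM) pw px /Defs.conj !(gE HG).
- by move=> k ki /=; rewrite qo ?po.
Qed.

Lemma twist_one i : is_twist i one (aut_one G).
Proof. by split=> //=; rewrite /Defs.conj !(gE HG). Qed.

Lemma twist_inv i v p : span (others i) v -> is_twist i v p ->
  is_twist i (inv v) (aut_inv p).
Proof.
move=> sv tp; have [q tq] := twist_ex (gen_inv sv).
suff -> : aut_inv p = q by [].
have := twist_mul (gen_inv sv) tp tq; rewrite (mulgV HG) => t1.
have [ap _ _] := tp; have [aq _ _] := tq; have [_ _ _ qK] := ap.
apply: aut_eq (is_aut_inv ap) aq _ => g /=.
by have := congr1 (fun t => p.2 (t.1 g)) (twist_eq t1 (twist_one i)); rewrite /= qK.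
Qed.

Lemma twist_hPS i v p : is_twist i v p -> hPS p.
Proof.
case=> ap px po; split=> // k; case: (eqVneq k i) => [->|ki]; first by exists v.
by exists one; rewrite po // /Defs.conj !(gE HG).
Qed.

(** Twisting is a homomorphism from H_i to hPSigma and so respects lower central series. It is given
    as a relation, so the argument of [hom_lcs] is repeated by induction. *)
Lemma twist_lcs i j v p : lcs mul inv one (span (others i)) j.+1 v ->
  is_twist i v p -> GamPS j.+1 p.
Proof.
elim: j v p => [|j IH] v p; first by move=> _; exact: twist_hPS.
rewrite !lcsS => hv.
have PM := gen_mul (mul := @aut_mul G) (inv := @aut_inv G) (one := aut_one G).
(* Membership in H_i is carried along because the existence of twists depends on it. *)
suff [_ h] : span (others i) v /\ forall p, is_twist i v p -> GamPS j.+2 p by exact: h.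
move: v hv {p}; apply: gen_ind.
- split=> [|p /twist_eq/(_ (twist_one i)) ->]; first exact: gen_one.
  exact: lcs_one hPS_one _.
- move=> a b [sa ha] [sb hb]; split=> [|p tp]; first exact: gen_mul.
  have [q tq] := twist_ex sa; have [r tr] := twist_ex sb.
  rewrite (twist_eq tp (twist_mul sb tq tr)).
  by apply: PM; [apply: ha|apply: hb].
- move=> a [sa ha]; split=> [|p tp]; first exact: gen_inv.
  have [q tq] := twist_ex sa.
  rewrite (twist_eq tp (twist_inv sa tq)).
  by apply: gen_inv; apply: ha.
- move=> _ [a [b [sa [hb ->]]]].
  have sb : span (others i) b.
    apply: lcs_sub hb; [exact: gen_one|exact: gen_mul|exact: gen_inv].
  have sab : span (others i) (comm a b).
    by apply: gen_mul; apply: gen_mul => //; exact: gen_inv.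
  split=> // p tp; have [q tq] := twist_ex sa; have [r tr] := twist_ex sb.
  have tqr : is_twist i (comm a b) (Defs.comm (@aut_mul G) (@aut_inv G) q r).
    apply: twist_mul; first by apply: gen_mul; exact: gen_inv.
    - exact: twist_mul.
    - by apply: twist_mul; [exact: gen_inv|exact: twist_inv|exact: twist_inv].
  rewrite (twist_eq tp tqr); apply: lcs_comm; first exact: twist_hPS tq.
  exact: IH hb tr.
Qed.

(** * Reaching the identity letter by letter, and the two inclusions *)

Lemma lcs_hPS_of_conj j p l : uniq l -> is_aut mul p ->
  (forall k, k \in l -> exists2 w, Gam j.+1 w & p.1 (x k) = conj (x k) w) ->
  (forall k, k \notin l -> p.1 (x k) = x k) -> GamPS j.+1 p.
Proof.
(* The list holds the letters that p may still move; composing with a twist removes its head. *)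
elim: l p => [|i l IH] p.
  move=> _ ap _ px; have -> : p = aut_one G.
    have [pM _ _ _] := ap.
    by apply: aut_eq ap (is_aut_one mul) _; apply: rf_hom_eq => // k; exact: px.
  exact: lcs_one hPS_one _.
move=> /andP[il ul] ap hp px; have [pM qM pK qK] := ap.
have [w gw ew] := hp i (mem_head _ _).
have [r kr] := kill_ex i; have [rM _] := kr.
have gv : Gam j.+1 (p.2 (inv w)) by apply: (gam_hom HG) => //; apply: gamV.
(* Chosen so that p(x_i^v) = p(x_i)^(w^-1) = x_i. Applying r does not change x_i^v and moves the
   conjugator into Gamma_{j+1}(H_i). *)
set v := r (p.2 (inv w)).
have lv : lcs mul inv one (span (others i)) j.+1 v.
  by apply: (hom_lcs HG HG rM) gv => b _; exact: kill_span.
have [t tt] := twist_ex (@kill_span _ _ (p.2 (inv w)) kr).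
have [at' tx to] := tt.
have ht := twist_lcs lv tt.
have -> : p = aut_mul (aut_mul p t) (aut_inv t).
  have [_ _ tK _] := at'.
  apply: (aut_eq ap) => [|g /=]; last by rewrite tK.
  exact: is_aut_mul (is_aut_mul ap at') (is_aut_inv at').
apply: lcs_mul; [exact: hPS_mul| |apply: lcs_inv; [exact: hPS_inv|exact: ht]].
apply: IH => //; first exact: is_aut_mul.
- move=> k kl; have ki : k != i by apply: contraNneq il => <-.
  by rewrite /= to //; apply: hp; rewrite inE kl orbT.
- move=> k kl /=; case: (eqVneq k i) => [->|ki].
    rewrite tx (kill_conj _ kr) (hom_conj HG HG pM) pK ew /Defs.conj.
    by rewrite !(gE HG).
  by rewrite to // px // inE negb_or ki.
Qed.

Lemma andreadakis_equality j p : GamPS j.+1 p <-> hPS p /\ A j.+1 p.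
Proof.
split=> [hp|[hp [ap Ap]]].
  split; last exact: lcs_hPS_andr.
  by apply: lcs_sub hp; [exact: hPS_one|exact: hPS_mul|exact: hPS_inv].
apply: (lcs_hPS_of_conj (enum_uniq 'I_n) ap) => k; last by rewrite mem_enum.
move=> _; have [_ /(_ k)[w ew]] := hp; have [r kr] := kill_ex k.
exists (r w); last by rewrite (kill_conj w kr).
(* The filtration condition is applied to x_k in Gamma_1, giving p(x_k) x_k^-1 in Gamma_{j+2}. *)
apply: (gam_of_conj kr); rewrite -ew -add1n.
by apply: Ap.
Qed.

End ReducedFree.

Theorem theorem4p9 (n : nat) (G : Type) (mul : G -> G -> G) (inv : G -> G)
  (one : G) (x : 'I_n -> G) :
  2 <= n -> is_reduced_free mul inv one x ->
  forall j : nat, 1 <= j ->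
  forall p : autT G,
    lcs (@aut_mul G) (@aut_inv G) (@aut_one G) (hPSigma mul inv x) j p <->
    (hPSigma mul inv x p /\ andreadakis mul inv one j p).
Proof. by move=> _ RF [//|j] _ p; exact: andreadakis_equality RF j p. Qed.
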